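(* Let $\Gamma$ be a countable discrete group with a non-singular Borel action on a standard Borel probability space $(X,\mu)$. If $\Gamma$ is not Choquet--Deny, or if it is not the case that $\mu$-almost every $\Gamma$-orbit in $X$ is finite, then the transformation groupoid $(\Gamma\ltimes X,\mu)$ admits a non-trivial Poisson boundary, i.e. there is a non-degenerate invariant Markov operator on $(\Gamma\ltimes X,\mu)$ whose Poisson boundary is non-trivial.
   Context: The transformation groupoid $\mathcal{G}=\Gamma\ltimes X$ is the set $\Gamma\times X$ with unit space $X$ (identified with $\{e\}\times X$), $s(g,x)=x$, $t(g,x)=g\cdot x$, and product $(g,h\cdot x)(h,x)=(gh,x)$. Non-singular means each group element preserves the class of $\mu$-null sets. Put $\mathcal{G}^x=t^{-1}(x)=\{(g,g^{-1}x):g\in\Gamma\}$. Markov operators. An invariant Markov operator $P$ on $\mathcal{G}$ is given by probability measures $d_xP$ on $\mathcal{G}^x$ ($x\in X$) such that for each non-negative Borel function $f$ on $\mathcal{G}$ the map $g\mapsto\sum_{h\in\mathcal{G}^{s(g)}}d_{s(g)}P(h)f(gh)$ is Borel. For each $x$, $P_x$ acts on $\ell^\infty(\mathcal{G}^x)$ by $P_xf(g)=\sum_{h\in\mathcal{G}^{s(g)}}d_{s(g)}P(h)f(gh)$. Powers $P^n$ ($n\ge1$) correspond to $d_xP^n(g)=\sum_{h\in\mathcal{G}^x}d_xP(h)\,d_{s(h)}P^{n-1}(h^{-1}g)$ (with $P^1=P$ for $n=1$). $P$ is non-degenerate if $\bigcup_{n\ge1}\{g\in\mathcal{G}^x:d_xP^n(g)>0\}=\mathcal{G}^x$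 for all $x\in X$. Poisson boundary. The Poisson boundary of $(\mathcal{G},\mu)$ with respect to a non-degenerate invariant Markov operator $P$ is the measurable field over $(X,\mu)$ of the Poisson boundaries of the operators $P_x$. It is trivial iff for $\mu$-almost every $x\in X$ the only functions $f\in\ell^\infty(\mathcal{G}^x)$ with $P_xf=f$ are the constants; otherwise it is non-trivial. Groups. A countable discrete group $\Gamma$ is Choquet--Deny if for every probability measure $\nu$ on $\Gamma$ whose support generates $\Gamma$ as a semigroup, every bounded $f:\Gamma\to\mathbb{C}$ with $f(g)=\sum_{h\in\Gamma}\nu(h)f(gh)$ for all $g$ is constant. *)

(* Defs.v *)
From HB Require Import structures.
From mathcomp Require Import all_boot all_order all_algebra.
From mathcomp Require Import all_classical all_reals all_analysis.
From mathcomp Require Import measurable_realfun.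
From mathcomp.analysis.showcase Require summability.
From mathcomp.real_closed Require Import complex.

Set Implicit Arguments.
Unset Strict Implicit.
Unset Printing Implicit Defensive.

Import Order.TTheory GRing.Theory Num.Theory.
Import numFieldNormedType.Exports.

Local Open Scope classical_set_scope.
Local Open Scope complex_scope.
Local Open Scope ring_scope.

(* Borel space of a separable complete metric space, up to isomorphism. *)
Definition standard_borel (R : realType) (d : measure_display)
    (X : measurableType d) : Prop :=
  exists (M : metricType R) (f : X -> M),
    [/\ bijective f,
        (forall F : set_system M, ProperFilter F -> cauchy F -> exists l : M, F --> l),
        (exists D : set M, countable D /\ dense D) &
        (forall A : set M, <<s [set U : set M | open U] >> A <->
                           measurable (f @^-1` A))].

(* Unconditional sum over D, as a limit along the finite subsets of D. It is
   only applied to absolutely convergent families (a probability times a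
   bounded function); elsewhere the value is a default one. *)
Definition csum (R : realType) (T : choiceType) (D : set T) (u : T -> R[i]) :
    R[i] :=
  @summability.sum T R[i] R[i]^o (patch (fun=> 0) D u).

Definition is_probability_on (R : realType) (T : choiceType) (D : set T)
    (p : T -> R) : Prop :=
  [/\ (forall h, 0 <= p h), (forall h, ~ D h -> p h = 0) &
      \esum_(h in D) (p h)%:E = 1%E].

Definition bounded_on (R : realType) (T : Type) (D : set T) (f : T -> R[i]) :
    Prop :=
  exists M : R, forall g, D g -> ComplexField.Normc.normc (f g) <= M.

Definition constant_on (R : realType) (T : Type) (D : set T) (f : T -> R[i]) :
    Prop :=
  exists c : R[i], forall g, D g -> f g = c.

Section ChoquetDeny.
Variables (R : realType) (gT : groupType).

Inductive semigroup_generated (S : set gT) : set gT :=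
| semigroup_gen g : S g -> semigroup_generated S g
| semigroup_mul g h : semigroup_generated S g -> semigroup_generated S h ->
    semigroup_generated S (g * h)%g.

(* Meant for countable gT. *)
Definition choquet_deny : Prop :=
  forall nu : gT -> R, is_probability_on setT nu ->
    semigroup_generated [set g | 0 < nu g] = setT ->
    forall f : gT -> R[i], bounded_on setT f ->
      (forall g, f g = csum setT (fun h => (nu h)%:C * f (g * h)%g)) ->
      constant_on setT f.

End ChoquetDeny.

Definition discrete_group (gT : groupType) : Type := gT.

Definition discrete_group_display : measure_display.
Proof. exact: default_measure_display. Qed.

Section DiscreteGroup.
Variable gT : groupType.

HB.instance Definition _ := Group.on (discrete_group gT).
HB.instance Definition _ := isPointed.Build (discrete_group gT) (1%g : gT).

Let all_set0 : [set: set (discrete_group gT)] set0. Proof. by []. Qed.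
Let all_setC A : [set: set (discrete_group gT)] A ->
  [set: set (discrete_group gT)] (~` A).
Proof. by []. Qed.
Let all_bigcup (F : (set (discrete_group gT))^nat) :
  (forall i, [set: set (discrete_group gT)] (F i)) ->
  [set: set (discrete_group gT)] (\bigcup_i (F i)).
Proof. by []. Qed.

HB.instance Definition _ := @isMeasurable.Build discrete_group_display
  (discrete_group gT) setT all_set0 all_setC all_bigcup.

End DiscreteGroup.

(* The carrier gT * X, with the product sigma-algebra. *)
Notation transf_groupoid gT X := (discrete_group gT * X)%type.

Section TransformationGroupoid.
Variables (R : realType) (gT : groupType) (d : measure_display).
Variables (X : measurableType d) (act : gT -> X -> X).

Definition is_action : Prop :=
  (forall x, act 1%g x = x) /\
  (forall g h x, act (g * h)%g x = act g (act h x)).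

(* As gT is discrete and countable in all uses, this is joint measurability. *)
Definition is_borel_action : Prop := forall g, measurable_fun setT (act g).

Definition is_nonsingular (mu : set X -> \bar R) : Prop :=
  forall g (A : set X), measurable A -> (mu (act g @` A) = 0%E <-> mu A = 0%E).

Definition act_orbit (x : X) : set X := [set act g x | g in setT].

Local Notation groupoid := (transf_groupoid gT X).

Definition gsource (g : groupoid) : X := g.2.
Definition gtarget (g : groupoid) : X := act g.1 g.2.
(* The product of g and h when gsource g = gtarget h, junk otherwise. *)
Definition gmul (g h : groupoid) : groupoid := ((g.1 * h.1)%g, h.2).
Definition ginv (g : groupoid) : groupoid := ((g.1^-1)%g, gtarget g).
Definition tfibre (x : X) : set groupoid := gtarget @^-1` [set x].

(* P x h is the mass at h of the probability measure on tfibre x. *)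
Definition is_markov_operator (P : X -> groupoid -> R) : Prop :=
  (forall x, is_probability_on (tfibre x) (P x)) /\
  (forall f : groupoid -> R, (forall g, 0 <= f g) -> measurable_fun setT f ->
     measurable_fun setT (fun g : groupoid =>
       \esum_(h in tfibre (gsource g)) (P (gsource g) h * f (gmul g h))%:E)).

(* Only the values of f on tfibre x matter for those of the result there. *)
Definition markov_apply (P : X -> groupoid -> R) (f : groupoid -> R[i])
    (g : groupoid) : R[i] :=
  csum (tfibre (gsource g)) (fun h => (P (gsource g) h)%:C * f (gmul g h)).

(* The power of exponent n.+1; meaningful at g in tfibre x. *)
Fixpoint markov_powS (P : X -> groupoid -> R) (n : nat) (x : X)
    (g : groupoid) : \bar R :=
  if n is m.+1 then
    (\esum_(h in tfibre x)
       ((P x h)%:E * markov_powS P m (gsource h) (gmul (ginv h) g)))%E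
  else (P x g)%:E.

Definition nondegenerate_markov (P : X -> groupoid -> R) : Prop :=
  forall x, \bigcup_n [set g | tfibre x g /\ (0 < markov_powS P n x g)%E] =
            tfibre x.

(* Elements of l^oo(tfibre x) are given by functions on the whole groupoid that
   are bounded on tfibre x. *)
Definition trivial_poisson_boundary (mu : {measure set X -> \bar R})
    (P : X -> groupoid -> R) : Prop :=
  {ae mu, forall x, forall f : groupoid -> R[i],
     bounded_on (tfibre x) f ->
     (forall g, tfibre x g -> markov_apply P f g = f g) ->
     constant_on (tfibre x) f}.

End TransformationGroupoid.

(* Main.v *)
Require Import Defs.
From HB Require Import structures.
From mathcomp Require Import all_boot all_order all_algebra finmap.
From mathcomp Require Import all_classical all_reals all_analysis.
From mathcomp Require Import measurable_realfun.
From mathcomp.analysis.showcase Require summability.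
From mathcomp.real_closed Require Import complex.
From mathcomp Require Import lra.

Set Implicit Arguments.
Unset Strict Implicit.
Unset Printing Implicit Defensive.

Import Order.TTheory GRing.Theory Num.Theory.
Import numFieldNormedType.Exports.

Local Open Scope classical_set_scope.
Local Open Scope ring_scope.

(** Write [p x] for a probability measure on the group depending measurably on
    the point [x]. Transporting [p x] to the fibre over [x] by
    [g |-> (g, g^-1 x)] gives an invariant Markov operator: from an element of
    source [x], multiply on the right by a random element drawn from [p x]. All
    operators below have this form ([walk_operator]).

    If the group is not Choquet-Deny, take [p x] to be a constant measure [nu]
    witnessing this. A bounded non-constant [nu]-harmonic function of the group
    component is harmonic on every fibre.

    Suppose now that the set of points with an infinite orbit is not negligible.
    The function on a fibre will be a function of the source, so it suffices to
    find a random walk on the points of each infinite orbit with a bounded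
    non-constant harmonic function.

    - Levels. There are disjoint Borel sets [L 0], [L 1], ... each of which
      meets every infinite orbit ([orbit_level]). Indeed, let [A] be a countable
      family of Borel sets, closed under complement and separating points.
      Start with the points of infinite orbit; at each stage, cut the current
      part of an orbit by the first [A i] that leaves infinitely many of its
      points inside and at least one outside ([orbit_half]). The points
      discarded at stage [k] form [L k].

    - The walk ([level_walk]). From a point of [L k] move, with probability
      [1 - 2^-(k+2)], to a chosen point of [L (k+2)] in the same orbit, and
      otherwise according to a fixed measure of full support. The latter makes
      the operator non-degenerate. Since the sum of the [2^-(k+2)] is small, the
      walk tends to keep the parity of its level forever.

    - A harmonic function. The function equal to [1 - 2^-(k+1)] on the [L k]
      with [k] of parity [b], and to 0 elsewhere, is subharmonic
      ([parity_barrier_sub]). So the even one is a subharmonic function below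
      one minus the odd one, which is superharmonic. The averaging operator
      being monotone, the supremum of the subharmonic functions below the latter
      is harmonic ([harmonic_between], a Knaster-Tarski argument). It is at
      least 1/2 on [L 0] and at most 1/4 on [L 1], hence non-constant on every
      infinite orbit. No measurability of the harmonic function is needed. *)

(** * Unconditional sums of complex families *)

Section UnconditionalSums.
Variable R : realType.
Local Open Scope complex_scope.

Lemma partial_sumE (I : choiceType) (V : zmodType) (u : I -> V) (A : {fset I}) :
  summability.partial_sum u A = \sum_(x <- A) u x.
Proof. by rewrite big_seq_fsetE. Qed.

(** Unconditional sums are limits along finite subsets, so a bijection [j] onto
    [D] identifies them: the two filters of partial sums coincide. No
    convergence is assumed. *)
Lemma csum_reindex (I J : choiceType) (D : set J) (j : I -> J) (i : J -> I)
    (u : J -> R[i]) :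
  cancel j i -> (forall x, D (j x)) -> (forall y, D y -> j (i y) = y) ->
  csum D u = csum setT (fun x => u (j x)).
Proof.
move=> ji Dj ij; rewrite /csum patch_setT /summability.sum.
have jinj : injective j := can_inj ji.
pose v := patch (fun=> 0) D u.
have vj x : v (j x) = u (j x) by rewrite /v patchT // inE.
have psE (A : {fset J}) (B : {fset I}) :
    (forall x, (x \in B) = (j x \in A)) ->
    summability.partial_sum v A = summability.partial_sum (u \o j) B.
  move=> AB; rewrite !partial_sumE.
  rewrite (bigID (fun y => y \in [set y | D y])) /=.
  rewrite [X in _ + X]big1 ?addr0; last first.
    by move=> y yD; rewrite /v patchC // inE /=; move: yD; rewrite notin_setE.
  rewrite -big_filter.
  rewrite [RHS](_ : _ = \sum_(y <- [seq j x | x <- B]) v y); last first.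
    by rewrite big_map; apply: eq_bigr => x _; rewrite /= vj.
  apply: perm_big; apply: uniq_perm.
  - by rewrite filter_uniq // fset_uniq.
  - by rewrite map_inj_uniq // fset_uniq.
  move=> y; rewrite mem_filter; apply/andP/mapP => [[yD yA]|[x xB ->]].
    by move: yD; rewrite inE => /ij yE; exists (i y); rewrite ?yE // AB yE.
  by rewrite inE -AB; split => //; exact: Dj.
pose pre (A : {fset J}) : {fset I} := [fset i y | y in A & `[< D y >]]%fset.
have preE A x : (x \in pre A) = (j x \in A).
  apply/imfsetP/idP => /= [[y /[!inE] /= /andP[yA /asboolP /ij yD] ->]|jxA].
    by rewrite yD.
  by exists (j x); rewrite ?ji // !inE /= jxA; apply/asboolP.
have -> // : summability.partial_sum v @ summability.totally =
             summability.partial_sum (u \o j) @ summability.totally.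
apply/predeqP => S; split => -[A _ AS].
- (* [A] may contain points outside [D], which do not contribute to the sum. *)
  exists (pre A) => // B preAB /=.
  rewrite -(psE (A `|` [fset j x | x in B])%fset); first exact/AS/fsubsetUl.
  move=> x; rewrite inE (mem_imfset _ _ jinj) /=.
  by case: (boolP (j x \in A)) => //=; rewrite -preE => /(fsubsetP preAB).
- exists [fset j x | x in A]%fset => // B AB /=.
  rewrite (psE _ (pre B) (preE B)); apply: AS; apply/fsubsetP => x xA.
  by rewrite preE; apply: (fsubsetP AB); rewrite mem_imfset.
Qed.

Lemma csum_real (T : choiceType) (r : T -> R) (s : R) :
  (forall x, 0 <= r x) -> \esum_(x in setT) (r x)%:E = s%:E ->
  csum setT (fun x => (r x)%:C) = s%:C.
Proof.
move=> r0 rs; rewrite /csum patch_setT /summability.sum.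
have psE (A : {fset T}) :
      summability.partial_sum (fun x => (r x)%:C) A =
      (\sum_(x <- A) r x)%:C :> R[i]^o.
  by rewrite partial_sumE rmorph_sum.
have leA (A : {fset T}) : \sum_(x <- A) r x <= s.
  rewrite -lee_fin -rs -sumEFin; apply: ereal_sup_ubound => /=.
  exists [set` A]; first by split => //; exact: finite_fset.
  by rewrite fsbig_finite //= set_fsetK.
have FF : ProperFilter (@summability.totally T).
  exact: summability.totally_filter.
apply: (@cvg_lim R[i]^o) => //.
apply/cvgrPdist_lt => /= e e0.
have [e' e'0 ee'] : exists2 e', 0 < e' & e = e'%:C.
  by case: e e0 => a b; rewrite ltcE /= => /andP[/eqP -> a0]; exists a.
have : ((s - e')%:E < \esum_(x in setT) (r x)%:E)%E.
  by rewrite rs lte_fin ltrBlDr ltrDl.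
move=> /ereal_sup_gt[_ [A [finA _] <-]].
rewrite fsbig_finite //= sumEFin lte_fin => sA.
exists (fset_set A) => // B AB /=; rewrite psE -rmorphB.
rewrite ger0_norm ?ler0c ?subr_ge0 ?leA // ee' ltcR ltrBlDr addrC -ltrBlDr.
apply: (lt_le_trans sA); rewrite [leRHS](big_fsetID _ (mem (fset_set A)) B) /=.
rewrite [X in _ <= X + _](_ : _ = \sum_(x <- fset_set A) r x).
  by rewrite lerDl sumr_ge0.
congr bigop; congr enum_fset; apply/fsetP => x; rewrite !inE /= andbC.
by apply: andb_idr; exact: (fsubsetP AB).
Qed.
End UnconditionalSums.

(** * Sums of non-negative families over a countable type *)

Section CountableSums.
Variable R : realType.
Local Open Scope ereal_scope.

Lemma esum_ge1 (T : choiceType) (D : set T) (a : T -> \bar R) (t : T) :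
  D t -> 0 <= a t -> a t <= \esum_(x in D) a x.
Proof.
move=> Dt at0; rewrite -(@esum_set1 R T t a) // /esum; apply: ereal_sup_le.
by move=> _ [X [finX Xt] <-]; exists X => //; split => // x /Xt ->.
Qed.

Lemma ge0_esumZl (T : choiceType) (D : set T) (a : T -> \bar R) (c : R) :
  (0 <= c)%R -> (forall t, 0 <= a t) ->
  \esum_(t in D) (c%:E * a t) = c%:E * \esum_(t in D) a t.
Proof.
have le1 (b : R) (u : T -> \bar R) : (0 <= b)%R -> (forall t, 0 <= u t) ->
    \esum_(t in D) (b%:E * u t) <= b%:E * \esum_(t in D) u t.
  move=> b0 u0; apply: ge_ereal_sup => _ [X DX <-].
  rewrite -ge0_mule_fsumr //; apply: lee_wpmul2l; first by rewrite lee_fin.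
  by apply: ereal_sup_ubound; exists X.
rewrite le_eqVlt => /predU1P[<- a0|c0 a0].
  by rewrite mul0e esum1 // => t _; rewrite mul0e.
apply/eqP; rewrite eq_le le1 ?(ltW c0) //=.
have /le1 : (0 <= c^-1)%R by rewrite invr_ge0 ltW.
move=> /(_ (fun t => c%:E * a t)) lec.
rewrite -lee_pdivlMl //.
rewrite (le_trans _ (lec _)) // => [|t]; last by rewrite mule_ge0 // lee_fin ltW.
apply: le_esum => t _.
by rewrite muleA -EFinM mulVf ?gt_eqF // mul1e.
Qed.

Lemma countable_retract (T : choiceType) (t0 : T) :
  countable [set: T] -> exists (n : T -> nat) (e : nat -> T), cancel n e.
Proof.
move=> /countable_injP[n ninj]; exists n, (fun i => xget t0 [set t | n t = i]).
move=> t /=; case: xgetP => [s _ /= ns|/(_ t) []//].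
by apply: ninj; rewrite ?inE.
Qed.

Lemma esum_cancel (T : choiceType) (n : T -> nat) (e : nat -> T)
    (a : T -> \bar R) : cancel n e -> (forall t, 0 <= a t) ->
  \esum_(t in setT) a t = \sum_(i <oo | i \in range n) a (e i).
Proof.
move=> ne a0; rewrite (reindex_esum (range n) setT e) ?nneseries_esum //.
  by rewrite set_mem_set.
split => //; last by move=> t _; exists (n t) => //; exists t.
by move=> _ _ /[!inE] -[s _ <-] [t _ <-]; rewrite !ne => ->.
Qed.

Lemma ge0_measurable_esum (d : measure_display) (Y : measurableType d)
    (T : choiceType) (t0 : T) (F : T -> Y -> \bar R) :
  countable [set: T] -> (forall t y, 0 <= F t y) ->
  (forall t, measurable_fun setT (F t)) ->
  measurable_fun setT (fun y => \esum_(t in setT) F t y).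
Proof.
move=> /(countable_retract t0)[n [e ne]] F0 mF.
under eq_fun do rewrite (esum_cancel ne) //.
exact: ge0_emeasurable_sum.
Qed.

Lemma full_support_probability (T : choiceType) (t0 : T) :
  countable [set: T] ->
  exists2 xi : T -> R, is_probability_on setT xi & forall t, (0 < xi t)%R.
Proof.
move=> /(countable_retract t0)[n [e ne]].
(* Normalise the summable positive family [t |-> 2^-(n t + 1)]. *)
pose a t : R := (1 / (2 ^ (n t).+1)%:R)%R.
have a0 t : (0 < a t)%R by rewrite divr_gt0 // ltr0n expn_gt0.
have c1 : \esum_(t in setT) (a t)%:E <= 1.
  rewrite (esum_cancel ne) => [|t]; last by rewrite lee_fin ltW.
  rewrite (eq_eseriesr (g := fun i => (1 / (2 ^ i.+1)%:R)%:E)) ?epsilon_trick0 //.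
  by move=> i; rewrite inE => -[t _ <-]; rewrite ne.
have c0 : 0 < \esum_(t in setT) (a t)%:E.
  apply: (@lt_le_trans _ _ (a t0)%:E); first by rewrite lte_fin.
  by apply: (@esum_ge1 _ _ (EFin \o a)) => //=; rewrite lee_fin ltW.
have [c cE] : exists c : R, \esum_(t in setT) (a t)%:E = c%:E.
  exists (fine (\esum_(t in setT) (a t)%:E)); rewrite fineK // ge0_fin_numE ?ltW //.
  exact: (le_lt_trans c1 (ltry _)).
move: c0; rewrite cE lte_fin => c0.
exists (fun t => c^-1 * a t)%R => [|t]; last by rewrite mulr_gt0 ?invr_gt0.
split => [t|t /(_ I)[]|].
  by rewrite mulr_ge0 ?invr_ge0 ?(ltW c0) ?(ltW (a0 t)).
transitivity (c^-1%:E * \esum_(t in setT) (a t)%:E).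
  rewrite -ge0_esumZl ?invr_ge0 ?(ltW c0) // => t.
  by rewrite lee_fin ltW.
by rewrite cE -EFinM mulVf ?gt_eqF.
Qed.

End CountableSums.

(** * Markov operators of random walks *)

Section WalkOperator.
Variables (R : realType) (gT : groupType) (d : measure_display).
Variables (X : measurableType d) (act : gT -> X -> X).
Hypothesis gT_countable : countable [set: gT].
Hypothesis act_action : is_action act.
Hypothesis act_borel : is_borel_action act.

Let act1 x : act 1%g x = x. Proof. by case: act_action. Qed.
Let actM g h x : act (g * h)%g x = act g (act h x).
Proof. by case: act_action. Qed.
Let actK g x : act g (act g^-1%g x) = x.
Proof. by rewrite -actM mulgV act1. Qed.
Let actVK g x : act g^-1%g (act g x) = x.
Proof. by rewrite -actM mulVg act1. Qed.

(** The Markov operator moving an element of source [x] by right multiplication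
    by a random [(g, g^-1 x)], where [g] has law [p x]. On the fibre over [x] an
    element is determined by its group component; off it the mass is 0. *)
Definition walk_operator (p : X -> gT -> R) (x : X)
    (h : transf_groupoid gT X) : R :=
  if gtarget act h == x then p x h.1 else 0.

(** The bijection from the group to the fibre of the target map over [x]. *)
Definition tfibre_point (x : X) (g : gT) : transf_groupoid gT X :=
  (g : discrete_group gT, act g^-1%g x).

Lemma tfibre_pointP x g : tfibre act x (tfibre_point x g).
Proof. by rewrite /tfibre /gtarget /= actK. Qed.

Lemma tfibre_pointK x h : tfibre act x h -> tfibre_point x h.1 = h.
Proof.
case: h => g y; rewrite /tfibre /gtarget /= => <-.
by rewrite /tfibre_point actVK.
Qed.

Lemma walk_operatorE p x g : walk_operator p x (tfibre_point x g) = p x g.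
Proof. by rewrite /walk_operator (tfibre_pointP x g) eqxx. Qed.

Lemma esum_tfibre x (a : transf_groupoid gT X -> \bar R) :
  \esum_(h in tfibre act x) a h = \esum_(g in [set: gT]) a (tfibre_point x g).
Proof.
apply: (reindex_esum setT (tfibre act x) (tfibre_point x)); split.
- by move=> g _; exact: tfibre_pointP.
- by move=> g h _ _ [].
- by move=> h /tfibre_pointK hx; exists h.1.
Qed.

Variable p : X -> gT -> R.
Hypothesis p_prob : forall x, is_probability_on setT (p x).

Let p_ge0 x g : 0 <= p x g. Proof. by case: (p_prob x). Qed.

Lemma markov_applyE (f : transf_groupoid gT X -> R[i])
    (g : transf_groupoid gT X) :
  markov_apply act (walk_operator p) f g =
  csum setT (fun k : gT =>
    ((p g.2 k)%:C)%C *
      f ((g.1 * k)%g : discrete_group gT, act k^-1%g g.2)).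
Proof.
rewrite /markov_apply /gsource.
rewrite (@csum_reindex R gT _ _ (tfibre_point g.2) fst) //.
- by congr csum; apply/funext => k; rewrite walk_operatorE.
- by move=> k; exact: tfibre_pointP.
- by move=> h /tfibre_pointK.
Qed.

Lemma walk_operator_markov :
  (forall g, measurable_fun setT (fun x => p x g)) ->
  is_markov_operator act (walk_operator p).
Proof.
move=> mp; split => [x|f f0 mf].
  split => [h|h|].
  - by rewrite /walk_operator; case: ifP.
  - by rewrite /walk_operator; case: eqP.
  - rewrite esum_tfibre; under eq_esum do rewrite walk_operatorE.
    by case: (p_prob x).
under eq_fun do rewrite esum_tfibre.
apply: (ge0_measurable_esum (1%g : gT) gT_countable) => [k g|k].
  by rewrite lee_fin walk_operatorE mulr_ge0.
apply/measurable_EFinP; apply: measurable_funM.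
  under eq_fun do rewrite walk_operatorE.
  exact: (measurableT_comp (mp k) measurable_snd).
apply: (measurableT_comp mf); apply: measurable_fun_pair => /=.
  (* Every function on a discrete group is measurable. *)
  exact: (@measurableT_comp _ _ _ _ _ _
    (fun g : discrete_group gT => (g * k)%g : discrete_group gT)).
exact: (measurableT_comp (act_borel k^-1%g) measurable_snd).
Qed.

Lemma walk_operator_powS_gt0 n x g h :
  0 < p x g ->
  (0 < markov_powS act (walk_operator p) n (act g^-1%g x)
         (tfibre_point (act g^-1%g x) h))%E ->
  (0 < markov_powS act (walk_operator p) n.+1 x (tfibre_point x (g * h)%g))%E.
Proof.
have pow_ge0 m y z : (0 <= markov_powS act (walk_operator p) m y z)%E.
  have P0 y' z' : 0 <= walk_operator p y' z' by rewrite /walk_operator; case: ifP.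
  elim: m y z => [|m IH] y z /=; first by rewrite lee_fin.
  by apply: esum_ge0 => z' _; rewrite mule_ge0 // lee_fin.
move=> pxg pow_gt0 /=.
apply: lt_le_trans (@esum_ge1 _ _ _ _ _ (tfibre_pointP x g) _); last first.
  by rewrite mule_ge0 // lee_fin walk_operatorE.
rewrite walk_operatorE mule_gt0 ?lte_fin //.
rewrite [X in markov_powS _ _ _ _ X](_ : _ = tfibre_point (act g^-1%g x) h) //.
by rewrite /gmul /ginv /tfibre_point /= mulKg invgM actM.
Qed.

End WalkOperator.

(** * Groups that are not Choquet-Deny *)

Section HomogeneousWalk.
Variables (R : realType) (gT : groupType) (d : measure_display).
Variables (X : measurableType d) (mu : probability X R) (act : gT -> X -> X).
Hypothesis gT_countable : countable [set: gT].
Hypothesis act_action : is_action act.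
Hypothesis act_borel : is_borel_action act.

Lemma homogeneous_walk_nondegenerate (nu : gT -> R) :
  is_probability_on setT nu ->
  semigroup_generated [set g | 0 < nu g] = setT ->
  nondegenerate_markov act (walk_operator act (fun=> nu)).
Proof.
move=> nu_prob nu_gen x; apply/seteqP; split => [h [n _ []] //|h hx].
pose W (g : gT) := exists n, forall y,
  (0 < markov_powS act (walk_operator act (fun=> nu)) n y
         (tfibre_point act y g))%E.
have W_gen g : 0 < nu g -> W g.
  by exists 0%N => y /=; rewrite lte_fin (walk_operatorE act_action).
have W_cons g h' : 0 < nu g -> W h' -> W (g * h')%g.
  move=> nug [n Wn]; exists n.+1 => y.
  exact: walk_operator_powS_gt0.
(* The second component lets a generated element be prefixed letter by letter,
   as the powers of the operator prepend one step at a time. *)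
suff /(_ h.1)[WM _] : forall g, W g /\ forall h', W h' -> W (g * h')%g.
  have [n Wn] := WM; exists n => //; split => //.
  by rewrite -(tfibre_pointK act_action hx).
move=> g; have : semigroup_generated [set g | 0 < nu g] g by rewrite nu_gen.
elim => [k nuk|k l _ [Wk kW] _ [Wl lW]].
  by split; [exact: W_gen|move=> h'; exact: W_cons].
by split => [|h' Wh']; rewrite -?mulgA; [exact: kW|exact/kW/lW].
Qed.

Lemma nontrivial_boundary_of_not_choquet_deny :
  ~ choquet_deny R gT ->
  exists P : X -> transf_groupoid gT X -> R,
    [/\ is_markov_operator act P, nondegenerate_markov act P &
        ~ trivial_poisson_boundary act mu P].
Proof.
move=> /existsNP[nu /not_implyP[nu_prob /not_implyP[nu_gen /existsNP[f]]]].
move=> /not_implyP[[M fM] /not_implyP[f_harm f_ncst]].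
exists (walk_operator act (fun=> nu)); split.
- exact: walk_operator_markov.
- exact: homogeneous_walk_nondegenerate.
move=> [A [mA A0 subA]].
have [x nAx] : exists x, ~ A x.
  apply: contrapT => /forallNP nA.
  have AT : A = setT by apply/seteqP; split => // x _; exact: contrapT.
  have := @probability_setT _ _ _ mu.
  by rewrite -AT A0 => /esym/eqP; rewrite onee_eq0.
apply: nAx; apply: subA => /(_ (fun g => f g.1)) /= triv.
apply: f_ncst; case: triv => [|g _|c fc].
- by exists M => g _; exact: fM.
- by rewrite markov_applyE // f_harm.
by exists c => g _; exact: (fc _ (tfibre_pointP act_action x g)).
Qed.

End HomogeneousWalk.

(** * First index of a sequence of sets *)

Section FirstIndex.

(** The least element of [D], and 0 if [D] is empty. *)
Definition first_index (D : set nat) : nat :=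
  xget 0%N [set m | D m /\ forall j, D j -> (m <= j)%N].

Lemma first_indexP (D : set nat) : D !=set0 -> D (first_index D).
Proof.
move=> [m Dm]; rewrite /first_index; case: xgetP => [k _ [] //|/= nD].
have exD : exists k, `[< D k >] by exists m; apply/asboolP.
case: (nD (ex_minn exD)); case: ex_minnP => k /asboolP Dk kmin.
by split => // j /asboolP; exact: kmin.
Qed.

Lemma first_index_eq (D : set nat) k : first_index D = k <->
  (D k /\ forall j, (j < k)%N -> ~ D j) \/ (k = 0%N /\ forall j, ~ D j).
Proof.
have [D0|/forallNP nD] := pselect (D !=set0); last first.
  rewrite /first_index; case: xgetP => [m _ [] /nD//|_].
  by split => [<-|[[/nD]//|[->]//]]; right.
have minD : forall j, D j -> (first_index D <= j)%N.
  by rewrite /first_index; case: xgetP => [m _ [] //|_ j]; rewrite leq0n.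
have DD := first_indexP D0.
split => [<-|[[Dk kmin]|[_ nD]]]; last by case: D0 => j /nD.
  by left; split => // j jk /minD; rewrite leqNgt jk.
apply/eqP; rewrite eqn_leq minD //= leqNgt; apply/negP => lt.
exact: (kmin _ lt DD).
Qed.

Variables (d : measure_display) (Y : measurableType d).

Lemma measurable_fun_nat (f : Y -> nat) :
  (forall k, measurable [set y | f y = k]) -> measurable_fun setT f.
Proof.
move=> mf _ B _; rewrite setTI.
rewrite (_ : f @^-1` B = \bigcup_(k in B) [set y | f y = k]).
  by apply: bigcup_measurable => k _; exact: mf.
by apply/predeqP => y; split => [By|[k Bk /= fk]]; [exists (f y)|rewrite /= fk].
Qed.

Lemma measurable_first_index (C : nat -> set Y) :
  (forall k, measurable (C k)) ->
  forall k, measurable [set y | first_index [set m | C m y] = k].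
Proof.
move=> mC k; rewrite (_ : [set _ | _] =
    (C k `&` \bigcap_(j in [set j | (j < k)%N]) ~` C j) `|`
    ([set _ | k = 0%N] `&` \bigcap_j ~` C j)); last first.
  apply/predeqP => y; rewrite /= first_index_eq.
  split=> -[[Ck Cj]|[k0 Cj]]; [left|right|left|right]; split => //.
    by move=> j _; exact: Cj.
  by move=> j; exact: Cj.
apply: measurableU; apply: measurableI => //.
- by apply: bigcap_measurableType => j _; exact: measurableC.
- have [->|k0] := eqVneq k 0%N.
    by rewrite (_ : [set _ | _] = setT) //; apply/seteqP.
  rewrite (_ : [set _ | _] = set0) //.
  by apply/seteqP; split => // y /= k0'; rewrite k0' in k0.
- by apply: bigcapT_measurable => j; exact: measurableC.
Qed.

End FirstIndex.

(** * A countable separating family of Borel sets *)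

Section BorelSeparation.
Variables (R : realType) (d : measure_display) (X : measurableType d).

Lemma standard_borel_separation : standard_borel R X ->
  exists A : nat -> set X, [/\ forall i, measurable (A i),
    forall x y, x <> y -> exists2 i, A i x & ~ A i y &
    forall i, exists j, A j = ~` A i].
Proof.
move=> [M [f [fbij _ [D [cD dD]] fM]]].
have [n ninj] := elimT (countable_injP D) cD.
(* The interiors of the balls of radius [1 / (m + 1)] centred at the dense set,
   indexed by numbering the dense set injectively by [n]; [U k m] is empty if no
   centre has number [k]. *)
pose U k m : set X := f @^-1` \bigcup_(z in [set z | D z /\ n z = k])
  (ball z (m.+1%:R^-1 : R))°.
have mU k m : measurable (U k m).
  apply: (proj1 (fM _)); apply: sub_sigma_algebra.
  by apply: bigcup_open => z _; exact: open_interior.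
have sepU x y : x <> y -> exists k m, U k m x /\ ~ U k m y.
  move=> xy; pose e := mdist (f x) (f y).
  have e0 : 0 < e by rewrite mdist_gt0; apply/eqP => /(bij_inj fbij).
  have [m me] : exists m, m.+1%:R^-1 < e / 2.
    have [|m] := @ltr_add_invr R 0 (e / 2); first by rewrite divr_gt0.
    by rewrite add0r; exists m.
  pose r : R := m.+1%:R^-1 / 2.
  have r0 : 0 < r by rewrite divr_gt0 // invr_gt0.
  have rE : m.+1%:R^-1 = r + r by rewrite /r -splitr.
  have [z [/interior_subset xz Dz]] : ((ball (f x) r)° `&` D) !=set0.
    apply: dD; last exact: open_interior.
    by exists (f x); exact: nbhsx_ballx.
  exists (n z), m; split.
    exists z => //; rewrite /interior rE; apply/nbhs_ballP; exists r => //= w.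
    by apply: ball_triangle; exact: ball_sym.
  move=> [w [Dw nw] /interior_subset wy].
  have wz : w = z by apply: ninj; rewrite ?inE.
  have : ball (f x) (r + m.+1%:R^-1) (f y).
    by apply: (ball_triangle xz); rewrite -wz.
  rewrite ballEmdist /= -/e; apply/negP; rewrite -leNgt.
  by rewrite (splitr e) lerD ?(ltW me) // (le_trans _ (ltW me)) // rE lerDl ltW.
pose A i := let: (b, k, m) := odflt (true, 0%N, 0%N) (choice.unpickle i) in
  if b then U k m else ~` U k m.
have AE b k m : A (choice.pickle (b, k, m)) = if b then U k m else ~` U k m.
  by rewrite /A choice.pickleK.
exists A; split.
- move=> i; rewrite /A; case: (odflt _ _) => -[[] k] m //; exact: measurableC.
- move=> x y /sepU[k [m [Ux Uy]]].
  by exists (choice.pickle (true, k, m)); rewrite AE.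
- move=> i; rewrite {2}/A; case: (odflt _ _) => -[b k] m.
  exists (choice.pickle (~~ b, k, m)); rewrite AE.
  by case: b => //=; rewrite setCK.
Qed.

End BorelSeparation.

(** * Borel levels meeting every infinite orbit *)

Section OrbitLevels.
Variables (gT : groupType) (d : measure_display) (X : measurableType d).
Variable act : gT -> X -> X.
Hypothesis gT_countable : countable [set: gT].
Hypothesis act_action : is_action act.
Hypothesis act_borel : is_borel_action act.

Variable A : nat -> set X.
Hypothesis A_measurable : forall i, measurable (A i).
Hypothesis A_sep : forall x y, x <> y -> exists2 i, A i x & ~ A i y.
Hypothesis A_compl : forall i, exists j, A j = ~` A i.

Local Notation orbit := (act_orbit act).

Lemma act_orbit_act g x : orbit (act g x) = orbit x.
Proof.
have [act1 actM] := act_action.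
apply/seteqP; split => _ [h _ <-].
  by exists (h * g)%g; rewrite // actM.
by exists (h * g^-1)%g; rewrite // actM -(actM g^-1%g) mulVg act1.
Qed.

Lemma act_orbitP x y : orbit x y -> orbit y = orbit x.
Proof. by move=> [g _ <-]; exact: act_orbit_act. Qed.

Lemma measurable_act_preimage g B : measurable B -> measurable (act g @^-1` B).
Proof. by move=> mB; rewrite -[X in measurable X]setTI; exact: act_borel. Qed.

Lemma measurable_orbit_meets B :
  measurable B -> measurable [set x | (orbit x `&` B) !=set0].
Proof.
move=> mB; have [n [e ne]] := countable_retract (1%g : gT) gT_countable.
rewrite (_ : [set _ | _] = \bigcup_i (act (e i) @^-1` B)).
  by apply: bigcupT_measurable => i; exact: measurable_act_preimage.
apply/predeqP => x; split => [[_ [[g _ <-] Bgx]]|[i _ Bx]].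
  by exists (n g) => //=; rewrite ne.
by exists (act (e i) x); split => //; exists (e i).
Qed.

Lemma measurable_act_eq g h : measurable [set x | act g x = act h x].
Proof.
rewrite (_ : [set _ | _] = ~` \bigcup_i (act g @^-1` A i `\` act h @^-1` A i)).
  apply: measurableC; apply: bigcupT_measurable => i.
  by apply: measurableD; exact: measurable_act_preimage.
apply/predeqP => x; split => [/= ghx [i _ [/= ?]]|nA]; first by rewrite -ghx.
by apply: contrapT => /A_sep[i Ag Ah]; apply: nA; exists i.
Qed.

Lemma measurable_orbit_infinite B :
  measurable B -> measurable [set x | infinite_set (orbit x `&` B)].
Proof.
move=> mB; have [n [e ne]] := countable_retract (1%g : gT) gT_countable.
(* The orbit meets [B] in a finite set iff, for some [N], each of its points in
   [B] is reached by one of the first [N] elements of the group. *)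
rewrite (_ : [set _ | _] = ~` \bigcup_N \bigcap_k
    (act (e k) @^-1` (~` B) `|`
     \bigcup_(i in [set i | (i < N)%N]) [set x | act (e i) x = act (e k) x])).
  apply: measurableC; apply: bigcupT_measurable => N.
  apply: bigcapT_measurable => k; apply: measurableU.
    by apply: measurable_act_preimage; exact: measurableC.
  by apply: bigcup_measurable => i _; exact: measurable_act_eq.
apply/predeqP => x; apply: not_iff_compat; split => [/finite_seqP[s sE]|[N _ finN]].
  pose idx z := xget 0%N [set i | act (e i) x = z].
  exists (\max_(z <- s) idx z).+1 => // k _.
  have [Bk|nBk] := pselect (B (act (e k) x)); [right|by left].
  exists (idx (act (e k) x)) => /=; last first.
    by rewrite /idx; case: xgetP => [i _ //|/(_ k) []].
  rewrite ltnS; apply: leq_bigmax_seq => //.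
  suff : [set` s] (act (e k) x) by [].
  by rewrite -sE; split => //; exists (e k).
apply: (@sub_finite_set _ _ ((fun i => act (e i) x) @` `I_N)).
  move=> _ [[g _ <-] Bgx]; have [|[i iN iE]] := finN (n g) I.
    by rewrite /= ne.
  by exists i => //; rewrite iE ne.
exact: finite_image.
Qed.

(** The first [i] such that [A i] cuts the part of the orbit of [x] lying in [S]
    into an infinite set, inside [A i], and a non-empty one, outside. *)
Definition orbit_cut (S : set X) (x : X) : nat :=
  first_index [set i | infinite_set (orbit x `&` (S `&` A i)) /\
                       (orbit x `&` (S `\` A i)) !=set0].

(** The points of [S] inside the set that cuts their orbit. *)
Definition orbit_half (S : set X) : set X :=
  [set x | S x /\ A (orbit_cut S x) x].

Lemma measurable_orbit_half S : measurable S -> measurable (orbit_half S).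
Proof.
move=> mS; pose C i := [set x | infinite_set (orbit x `&` (S `&` A i))] `&`
  [set x | (orbit x `&` (S `\` A i)) !=set0].
have mC i : measurable (C i).
  apply: measurableI.
    by apply: measurable_orbit_infinite; exact: measurableI.
  by apply: measurable_orbit_meets; exact: measurableD.
rewrite (_ : orbit_half S =
    \bigcup_i ([set x | orbit_cut S x = i] `&` (S `&` A i))).
  apply: bigcupT_measurable => i; apply: measurableI; last exact: measurableI.
  exact: measurable_first_index.
apply/predeqP => x; split => [[Sx Ax]|[i _ [/= cx [Sx Ax]]]].
  by exists (orbit_cut S x).
by split; rewrite ?cx.
Qed.

Lemma orbit_halfP S x : infinite_set (orbit x `&` S) ->
  infinite_set (orbit x `&` orbit_half S) /\
  (orbit x `&` (S `\` orbit_half S)) !=set0.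
Proof.
move=> infS; set c := orbit_cut S x.
have cutE y : orbit x y -> orbit_cut S y = c.
  by move=> /act_orbitP xy; rewrite /c /orbit_cut xy.
suff [infc [y [xy [Sy nAy]]]] : infinite_set (orbit x `&` (S `&` A c)) /\
    (orbit x `&` (S `\` A c)) !=set0.
  split; last by exists y; split => //; split => // -[_]; rewrite cutE.
  apply: sub_infinite_set infc => z [xz [Sz Az]].
  by split => //; split => //; rewrite cutE.
apply: (@first_indexP [set i | infinite_set (orbit x `&` (S `&` A i)) /\
                               (orbit x `&` (S `\` A i)) !=set0]).
have [y [xy Sy]] := infinite_setN0 infS.
have [z [[xz Sz] zy]] := infinite_setN0 (infinite_setD infS (finite_set1 y)).
have [i Ay nAz] : exists2 i, A i y & ~ A i z.
  by apply: A_sep => yz; apply: zy; rewrite yz.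
(* [A i] separates [y] from [z]. Either it or its complement contains infinitely
   many points of the orbit in [S]. *)
have [infA|finA] := pselect (infinite_set (orbit x `&` (S `&` A i))).
  by exists i; split => //; exists z.
have [j jE] := A_compl i; exists j; rewrite /= jE; split; last first.
  by exists y; split => //; split => // /(_ Ay).
move=> finC; apply: infS.
rewrite (_ : orbit x `&` S =
    (orbit x `&` (S `&` A i)) `|` (orbit x `&` (S `&` ~` A i))).
  by rewrite finite_setU; split => //; exact: contrapT.
by rewrite -setIUr -setIUr setUCr setIT.
Qed.

(** The part of the infinite orbits that remains after [n] cuts. *)
Fixpoint orbit_stage (n : nat) : set X :=
  if n is m.+1 then orbit_half (orbit_stage m)
  else [set x | infinite_set (orbit x)].

(** The points removed by the cut of rank [n]. *)
Definition orbit_level (n : nat) : set X := orbit_stage n `\` orbit_stage n.+1.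

Lemma measurable_orbit_level n : measurable (orbit_level n).
Proof.
have mst k : measurable (orbit_stage k).
  elim: k => [|k IH] /=; last exact: measurable_orbit_half.
  rewrite (_ : [set _ | _] = [set x | infinite_set (orbit x `&` setT)]).
    exact: measurable_orbit_infinite.
  by apply/predeqP => x; rewrite /= setIT.
exact: measurableD.
Qed.

Lemma orbit_level_inj m n x : orbit_level m x -> orbit_level n x -> m = n.
Proof.
have stage_le i j : (i <= j)%N -> orbit_stage j `<=` orbit_stage i.
  elim: j => [|j IH]; first by rewrite leqn0 => /eqP ->.
  by rewrite leq_eqVlt => /predU1P[->//|/IH ji y [/ji]].
suff lt i j : (i < j)%N -> orbit_level i x -> ~ orbit_level j x.
  move=> mx nx; case: (ltngtP m n) => // [/lt /(_ mx)|/lt /(_ nx)] //.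
by move=> /stage_le ij [_ ni] [/ij].
Qed.

Lemma orbit_level_infinite n x : orbit_level n x -> infinite_set (orbit x).
Proof. by move=> [+ _]; elim: n => [//|n IH] /= [/IH]. Qed.

Lemma infinite_orbit_level x n : infinite_set (orbit x) ->
  exists g, orbit_level n (act g x).
Proof.
move=> infx; have infst : infinite_set (orbit x `&` orbit_stage n).
  elim: n => [|n /orbit_halfP[]//].
  rewrite (_ : _ `&` _ = orbit x) //; apply/seteqP; split => [y []//|y xy].
  by split => //=; rewrite (act_orbitP xy).
by have [_ [_ [[g _ <-] gx]]] := orbit_halfP infst; exists g.
Qed.

End OrbitLevels.

(** * Harmonic functions between sub- and superharmonic ones *)

Section HarmonicSqueeze.
Variables (R : realType) (gT : groupType) (X : Type) (act : gT -> X -> X).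
Variable p : X -> gT -> R.
Hypothesis p_prob : forall x, is_probability_on setT (p x).
Local Open Scope ereal_scope.

(** The mean of [v] after one step of the walk on [X] that moves [x] to
    [g^-1 x], where [g] has law [p x]. The function [v] is extended real valued
    so that arbitrary suprema exist. *)
Definition walk_mean (v : X -> \bar R) (x : X) : \bar R :=
  \esum_(g in [set: gT]) ((p x g)%:E * v (act g^-1%g x)).

Let p_ge0 x g : 0 <= (p x g)%:E.
Proof. by rewrite lee_fin; case: (p_prob x). Qed.

Lemma le_walk_mean v w x :
  (forall y, v y <= w y) -> walk_mean v x <= walk_mean w x.
Proof. by move=> vw; apply: le_esum => g _; exact: lee_wpmul2l. Qed.

(** The mean of [1 - v] is one minus the mean of [v], stated without
    subtraction. *)
Lemma walk_mean_compl (v : X -> R) x : (forall y, (0 <= v y <= 1)%R) ->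
  walk_mean (fun y => (1 - v y)%:E) x + walk_mean (EFin \o v) x = 1.
Proof.
move=> v01; rewrite -esumD => [|g _|g _].
- under eq_esum do rewrite /= -muleDr ?fin_num_adde_defl // -EFinD subrK mule1.
  by case: (p_prob x).
- by rewrite mule_ge0 // lee_fin subr_ge0; case/andP: (v01 (act g^-1%g x)).
- by rewrite mule_ge0 // lee_fin; case/andP: (v01 (act g^-1%g x)).
Qed.

(** The harmonic function is the largest subharmonic one below [w]: its mean is
    also subharmonic and below [w]. *)
Lemma harmonic_between (v w : X -> \bar R) :
  (forall x, v x <= w x) -> (forall x, v x <= walk_mean v x) ->
  (forall x, walk_mean w x <= w x) ->
  exists u : X -> \bar R,
    forall x, [/\ v x <= u x, u x <= w x & walk_mean u x = u x].
Proof.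
move=> vw vsub wsup.
pose S := [set s : X -> \bar R |
  forall x, s x <= w x /\ s x <= walk_mean s x].
pose u x := ereal_sup [set s x | s in S].
have leu s x : S s -> s x <= u x by move=> Ss; apply: ereal_sup_ubound; exists s.
have uw x : u x <= w x by apply: ge_ereal_sup => _ [s Ss <-]; case: (Ss x).
have usub x : u x <= walk_mean u x.
  apply: ge_ereal_sup => _ [s Ss <-]; have [_ /le_trans] := Ss x; apply.
  by apply: le_walk_mean => y; exact: leu.
exists u => x; split => //; first by apply: leu => y.
apply/eqP; rewrite eq_le usub andbT; apply: (leu (walk_mean u)) => y; split.
  exact: le_trans (le_walk_mean _ uw) (wsup y).
by apply: le_walk_mean => z; exact: usub.
Qed.

End HarmonicSqueeze.

(** * The walk climbing the levels of its orbit *)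

Section LevelWalk.
Variables (R : realType) (gT : groupType) (d : measure_display).
Variables (X : measurableType d) (act : gT -> X -> X).
Hypothesis act_action : is_action act.
Hypothesis act_borel : is_borel_action act.

Variables (n : gT -> nat) (e : nat -> gT).
Hypothesis ne : cancel n e.
Variable xi : gT -> R.
Hypothesis xi_prob : is_probability_on setT xi.
Hypothesis xi_gt0 : forall g, 0 < xi g.

Variable L : nat -> set X.
Hypothesis L_measurable : forall k, measurable (L k).
Hypothesis L_inj : forall i j x, L i x -> L j x -> i = j.
Hypothesis L_meets : forall i j x, L i x -> exists g, L j (act g x).

(** The level containing [x]; 0 if there is none. *)
Definition level (x : X) : nat := first_index [set k | L k x].

(** The first element, in the enumeration [e], whose inverse brings [x] two
    levels up. *)
Definition climb_index (x : X) : nat :=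
  first_index [set i | L (level x).+2 (act (e i)^-1%g x)].

Definition climb (x : X) : gT := e (climb_index x).

Definition level_weight (k : nat) : R := (2 ^+ k.+1)^-1.

(** Climb two levels, except with probability [2^-(k+2)] at a point of level
    [k], where the step has law [xi]. *)
Definition level_walk (x : X) (g : gT) : R :=
  (1 - level_weight (level x).+1) * (g == climb x)%:R
  + level_weight (level x).+1 * xi g.

Lemma levelE k x : L k x -> level x = k.
Proof.
by move=> Lk; apply: (L_inj _ Lk); apply: (@first_indexP [set k | L k x]); exists k.
Qed.

Lemma climbP k x : L k x -> L k.+2 (act (climb x)^-1%g x).
Proof.
move=> Lk; rewrite /climb /climb_index (levelE Lk).
apply: (@first_indexP [set i | L k.+2 (act (e i)^-1%g x)]).
by have [g Lg] := L_meets k.+2 Lk; exists (n g^-1%g); rewrite /= ne invgK.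
Qed.

Lemma level_weight_gt0 k : 0 < level_weight k.
Proof. by rewrite invr_gt0 exprn_gt0. Qed.

Lemma level_weight_lt1 k : level_weight k < 1.
Proof. by rewrite invf_lt1 ?exprn_gt0 // exprn_egt1 // ltr1n. Qed.

Lemma level_weightS k : level_weight k.+1 = level_weight k / 2.
Proof. by rewrite /level_weight exprS invfM mulrC. Qed.

Lemma level_walk_gt0 x g : 0 < level_walk x g.
Proof.
rewrite ltr_wpDl ?mulr_gt0 ?level_weight_gt0 //.
by rewrite mulr_ge0 // subr_ge0 ltW ?level_weight_lt1.
Qed.

Lemma level_walk_prob x : is_probability_on setT (level_walk x).
Proof.
have eps0 := level_weight_gt0 (level x).+1.
have eps1 := level_weight_lt1 (level x).+1.
have [xi0 _ xi1] := xi_prob.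
split => [g|g /(_ I)[]|]; first exact/ltW/level_walk_gt0.
pose delta g : R := (g == climb x)%:R.
have delta1 : \esum_(g in [set: gT]) (delta g)%:E = 1%E.
  rewrite -(@esum_set1 R gT (climb x) (fun=> 1%E)) // [RHS]esum_mkcond.
  apply: eq_esum => g _; rewrite /delta; case: eqP => [->|gx].
    by rewrite mem_set.
  by rewrite memNset.
transitivity (
  (1 - level_weight (level x).+1)%:E * (\esum_(g in [set: gT]) (delta g)%:E) +
  (level_weight (level x).+1)%:E * \esum_(g in [set: gT]) (xi g)%:E)%E.
  have epsC : 0 <= 1 - level_weight (level x).+1 by rewrite subr_ge0 ltW.
  have del0 g : (0 <= (delta g)%:E)%E by rewrite lee_fin.
  have xiE0 g : (0 <= (xi g)%:E)%E by rewrite lee_fin.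
  rewrite -(ge0_esumZl _ epsC del0) -(ge0_esumZl _ (ltW eps0) xiE0) -esumD //.
  - by move=> g _; rewrite mule_ge0 // lee_fin.
  - by move=> g _; rewrite mule_ge0 // lee_fin ltW.
by rewrite delta1 xi1 !mule1 -EFinD subrK.
Qed.

Lemma measurable_level_walk g : measurable_fun setT (fun x => level_walk x g).
Proof.
have mlevel : measurable_fun setT level.
  by apply: measurable_fun_nat => k; exact: measurable_first_index.
have mclimb : measurable_fun setT climb_index.
  apply: measurable_fun_nat.
  apply: (@measurable_first_index _ _
    (fun i => [set x | L (level x).+2 (act (e i)^-1%g x)])).
  move=> i; rewrite (_ : [set _ | _] = \bigcup_k (level @^-1` [set k] `&`
      act (e i)^-1%g @^-1` L k.+2)).
    apply: bigcupT_measurable => k; apply: measurableI.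
      by rewrite -[X in measurable X]setTI; exact: mlevel.
    exact: measurable_act_preimage.
  by apply/predeqP => x; split => [Lx|[k _ [/= <-]] //]; exists (level x).
have mnat (Y : R^nat) f :
    measurable_fun setT f -> measurable_fun setT (Y \o f : X -> R).
  by move=> mf; apply: measurableT_comp.
apply: measurable_funD; apply: measurable_funM => //.
- exact: (mnat (fun k => 1 - level_weight k.+1)).
- exact: (mnat (fun i => (g == e i)%:R)).
- exact: (mnat (fun k => level_weight k.+1)).
Qed.

(** A lower bound for the probability that the walk started at [x] stays forever
    on levels whose parity is even ([b = false]) or odd ([b = true]). *)
Definition parity_barrier (b : bool) (x : X) : R :=
  if `[< L (level x) x >] && (odd (level x) == b) then 1 - level_weight (level x)
  else 0.

Lemma parity_barrierE k x : L k x -> parity_barrier (odd k) x = 1 - level_weight k.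
Proof.
by move=> Lk; rewrite /parity_barrier (levelE Lk) asboolT // eqxx.
Qed.

Lemma parity_barrier_ge0 b x : 0 <= parity_barrier b x.
Proof.
rewrite /parity_barrier; case: ifP => // _.
by rewrite subr_ge0 ltW ?level_weight_lt1.
Qed.

Lemma parity_barrier_sum x : parity_barrier false x + parity_barrier true x <= 1.
Proof.
have w0 := level_weight_gt0 (level x).
rewrite /parity_barrier; by case: asboolP => _ /=; [case: odd => /=|]; lra.
Qed.

Lemma parity_barrier_sub b x :
  ((parity_barrier b x)%:E <=
    walk_mean act level_walk (EFin \o parity_barrier b) x)%E.
Proof.
have mean_ge0 c g : (0 <= (level_walk x g)%:E *
    (EFin \o parity_barrier c) (act g^-1%g x))%E.
  by rewrite mule_ge0 // lee_fin ?parity_barrier_ge0 // ltW ?level_walk_gt0.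
rewrite {1}/parity_barrier.
case: ifPn => [/andP[/asboolP Lx /eqP <-]|_]; last first.
  by apply: esum_ge0 => g _; exact: mean_ge0.
(* Keep only the climbing step. *)
apply: le_trans (@esum_ge1 R gT setT _ (climb x) I (mean_ge0 _ _)).
have /= := parity_barrierE (climbP Lx); rewrite negbK /= => ->.
rewrite -EFinM lee_fin !level_weightS.
set t := level_weight (level x).
have t0 : 0 < t := level_weight_gt0 _.
have t1 : t < 1 := level_weight_lt1 _.
have xi0 : 0 <= t / 2 * xi (climb x) by rewrite !mulr_ge0 ?ltW ?invr_gt0.
apply: (@le_trans _ _ ((1 - t / 2) * (1 - t / 2 / 2))); first by nra.
apply: ler_wpM2r; first by lra.
by rewrite /level_walk level_weightS eqxx mulr1 -/t lerDl.
Qed.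

Lemma level_walk_harmonic :
  exists r : X -> R, [/\ forall x, 0 <= r x <= 1,
    forall x, \esum_(g in [set: gT])
      (level_walk x g * r (act g^-1%g x))%:E = (r x)%:E,
    forall x, L 0%N x -> 1 / 2 <= r x &
    forall x, L 1%N x -> r x <= 1 / 4].
Proof.
have bar01 b x : 0 <= parity_barrier b x <= 1.
  rewrite parity_barrier_ge0 /=; have := parity_barrier_sum x.
  have := parity_barrier_ge0 true x; have := parity_barrier_ge0 false x.
  by case: b; lra.
have [||x|u uP] := @harmonic_between _ _ _ act _ level_walk_prob
  (fun x => (parity_barrier false x)%:E)
  (fun x => (1 - parity_barrier true x)%:E).
- by move=> x; rewrite lee_fin; have := parity_barrier_sum x; lra.
- exact: parity_barrier_sub.
- have := walk_mean_compl act level_walk_prob x (bar01 true).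
  have := parity_barrier_sub true x.
  case: (walk_mean _ _ (EFin \o _) _) => [s| |//];
    case: (walk_mean _ _ _ _) => [t| |] //=.
  by rewrite lee_fin => le_s [ts]; rewrite lee_fin; lra.
have uE x : u x = (fine (u x))%:E.
  have [vu uw _] := uP x; rewrite fineK // fin_real //.
  by rewrite (lt_le_trans (ltNyr _) vu) (le_lt_trans uw (ltry _)).
exists (fine \o u); split => x /=.
- have [+ + _] := uP x; rewrite uE !lee_fin => vu uw.
  by have /andP[] := bar01 false x; have /andP[] := bar01 true x; lra.
- have [_ _ meanE] := uP x; rewrite -uE -[RHS]meanE.
  by apply: eq_esum => g _; rewrite EFinM -uE.
- move=> /parity_barrierE /= b0; have [+ _ _] := uP x.
  by rewrite uE lee_fin b0 /level_weight expr1; lra.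
- move=> /parity_barrierE /= b1; have [_ + _] := uP x.
  by rewrite uE lee_fin b1 /level_weight; lra.
Qed.

End LevelWalk.

(** * Actions with infinite orbits *)

Section InfiniteOrbits.
Variables (R : realType) (gT : groupType) (d : measure_display).
Variables (X : measurableType d) (mu : probability X R) (act : gT -> X -> X).
Hypothesis gT_countable : countable [set: gT].
Hypothesis act_action : is_action act.
Hypothesis act_borel : is_borel_action act.

Lemma nontrivial_boundary_of_infinite_orbits :
  standard_borel R X ->
  ~ {ae mu, forall x, finite_set (act_orbit act x)} ->
  exists P : X -> transf_groupoid gT X -> R,
    [/\ is_markov_operator act P, nondegenerate_markov act P &
        ~ trivial_poisson_boundary act mu P].
Proof.
move=> /standard_borel_separation[A [mA A_sep A_compl]] inf_orbits.
have [n [e ne]] := countable_retract (1%g : gT) gT_countable.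
have [xi xi_prob xi_gt0] := full_support_probability R (1%g : gT) gT_countable.
pose L := orbit_level act A.
have mL k : measurable (L k) by exact: measurable_orbit_level.
have L_inj i j x : L i x -> L j x -> i = j by exact: orbit_level_inj.
have L_orbit x k : infinite_set (act_orbit act x) -> exists g, L k (act g x).
  exact: infinite_orbit_level.
have L_meets i j x : L i x -> exists g, L j (act g x).
  by move=> /orbit_level_infinite; exact: L_orbit.
pose p := level_walk act e xi L.
have p_prob x : is_probability_on setT (p x) by exact: level_walk_prob.
have p_gt0 x g : 0 < p x g by exact: level_walk_gt0.
exists (walk_operator act p); split.
- by apply: walk_operator_markov => // g; exact: measurable_level_walk.
- move=> x; apply/seteqP; split => [h [m _ []] //|h hx].
  exists 0%N => //; split => //=; rewrite lte_fin.
  by rewrite -(tfibre_pointK act_action hx) walk_operatorE.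
move=> triv; apply: inf_orbits; apply: filterS triv => x triv.
apply: contrapT => /L_orbit L_x.
have [r [r01 r_harm r0 r1]] :=
  level_walk_harmonic ne xi_prob xi_gt0 L_inj L_meets.
pose f (h : transf_groupoid gT X) : R[i] := ((r h.2)%:C)%C.
have [|h hx|c fc] := triv f.
- exists 1 => h _; rewrite /f /= expr0n addr0 sqrtr_sqr ger0_norm.
    by case/andP: (r01 h.2).
  by case/andP: (r01 h.2).
- rewrite markov_applyE // /f /=.
  under eq_fun do rewrite -rmorphM.
  apply: csum_real => [k|]; last exact: r_harm.
  by rewrite mulr_ge0 ?(ltW (p_gt0 _ _)) //; case/andP: (r01 (act k^-1%g h.2)).
have r_cst g : ((r (act g x))%:C)%C = c.
  by rewrite -(fc _ (tfibre_pointP act_action x g^-1%g)) /f /= invgK.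
have [g0 /r0 +] := L_x 0%N; have [g1 /r1 +] := L_x 1%N.
have [->] : ((r (act g1 x))%:C)%C = ((r (act g0 x))%:C)%C by rewrite !r_cst.
lra.
Qed.

End InfiniteOrbits.

Theorem corollaryB (R : realType) (gT : groupType) (d : measure_display)
    (X : measurableType d) (mu : probability X R) (act : gT -> X -> X) :
  countable [set: gT] ->
  standard_borel R X ->
  is_action act ->
  is_borel_action act ->
  is_nonsingular act mu ->
  ~ choquet_deny R gT \/ ~ {ae mu, forall x, finite_set (act_orbit act x)} ->
  exists P : X -> transf_groupoid gT X -> R,
    [/\ is_markov_operator act P, nondegenerate_markov act P &
        ~ trivial_poisson_boundary act mu P].
Proof.
move=> gT_countable X_standard act_action act_borel _ [nCD|inf_orbits].
  exact: nontrivial_boundary_of_not_choquet_deny.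
exact: nontrivial_boundary_of_infinite_orbits.
Qed.
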